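(* Every $\aleph_1$-copresentable object in $\mathsf{PosComp}$ is metrisable.
   Context: A partially ordered compact space is a triple $(X,\leq,\tau)$ where $\leq$ is a partial order on the set $X$ and $\tau$ is a compact topology on $X$ such that $\{(x,y)\mid x\leq y\}$ is closed in $X\times X$. $\mathsf{PosComp}$ is the category of these spaces and monotone continuous maps. An object $X$ of a category $\mathsf{C}$ is $\aleph_1$-copresentable if $\hom(-,X)\colon\mathsf{C}^{\mathrm{op}}\to\mathsf{Set}$ preserves $\aleph_1$-filtered (equivalently, $\aleph_1$-directed) colimits, i.e. it sends limits of $\aleph_1$-codirected diagrams in $\mathsf{C}$ to colimits in $\mathsf{Set}$. A metric space here is a pair $(X,a)$ with $a\colon X\times X\to[0,1]$ satisfying $a(x,x)=0$ and $a(x,z)\leqslant\min(1,a(x,y)+a(y,z))$ for all $x,y,z\in X$ (no symmetry or separation required). The order induced by $a$ is: $x\leq y$ iff $a(x,y)=0$. The topology induced by $a$ is the one induced by the symmetrisation $a_s(x,y)=\max(a(x,y),a(y,x))$. A partially ordered compact space $X$ is metrisable if there is a metric (in this sense) on $X$ inducing both the order and the topology of $X$. *)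

(* Defs.v *)
From HB Require Import structures.
From mathcomp Require Import all_boot all_order all_algebra.
From mathcomp Require Import all_classical all_reals all_analysis.

Set Implicit Arguments.
Unset Strict Implicit.
Unset Printing Implicit Defensive.

Import Order.TTheory GRing.Theory Num.Theory.
Local Open Scope classical_set_scope.
Local Open Scope ring_scope.

Record category := Category {
  obj :> Type;
  hom : obj -> obj -> Type;
  idm : forall x, hom x x;
  compm : forall x y z, hom y z -> hom x y -> hom x z;
  compm_idl : forall x y (f : hom x y), compm (idm y) f = f;
  compm_idr : forall x y (f : hom x y), compm f (idm x) = f;
  compmA : forall x y z w (h : hom z w) (g : hom y z) (f : hom x y),
    compm h (compm g f) = compm (compm h g) f }.

Definition op (C : category) : category :=
  @Category C (fun x y => hom y x) (@idm C) (fun x y z g f => compm f g)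
    (fun x y f => compm_idr f) (fun x y f => compm_idl f)
    (fun x y z w h g f => esym (compmA f g h)).

(* The category Set, with Coq types (of a fixed universe) as sets. *)
Definition type_cat : category :=
  @Category Type (fun A B => A -> B) (fun A => @id A)
    (fun A B C g f x => g (f x))
    (fun A B f => erefl) (fun A B f => erefl)
    (fun A B C D h g f => erefl).

Definition poset_cat (d : Order.disp_t) (J : porderType d) : category :=
  @Category J (fun i j => (i <= j)%O) (fun i => lexx i)
    (fun i j k jk ij => le_trans ij jk)
    (fun i j f => bool_irrelevance _ _) (fun i j f => bool_irrelevance _ _)
    (fun i j k l h g f => bool_irrelevance _ _).

Record functor (C D : category) := Functor {
  fobj :> C -> D;
  fmap : forall x y, hom x y -> hom (fobj x) (fobj y);
  fmap1 : forall x, fmap (idm x) = idm (fobj x);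
  fmap_comp : forall x y z (g : hom y z) (f : hom x y),
    fmap (compm g f) = compm (fmap g) (fmap f) }.

Lemma fcomp_fmap1 (C D E : category) (G : functor D E) (F : functor C D)
  (x : C) : fmap G (fmap F (idm x)) = idm (G (F x)).
Proof. by rewrite !fmap1. Qed.

Lemma fcomp_fmap_comp (C D E : category) (G : functor D E) (F : functor C D)
  (x y z : C) (g : hom y z) (f : hom x y) :
  fmap G (fmap F (compm g f)) = compm (fmap G (fmap F g)) (fmap G (fmap F f)).
Proof. by rewrite !fmap_comp. Qed.

Definition fcomp (C D E : category) (G : functor D E) (F : functor C D) :
    functor C E :=
  @Functor C E (fun x => G (F x)) (fun x y f => fmap G (fmap F f))
    (fcomp_fmap1 G F) (@fcomp_fmap_comp C D E G F).

Record cocone (J C : category) (D : functor J C) := Cocone {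
  apex : C;
  leg : forall j, hom (D j) apex;
  leg_natural : forall i j (u : hom i j), compm (leg j) (fmap D u) = leg i }.

Definition is_colimit (J C : category) (D : functor J C) (c : cocone D) : Prop :=
  forall c' : cocone D,
    exists! u : hom (apex c) (apex c'), forall j, compm u (leg c j) = leg c' j.

Lemma map_cocone_natural (J C E : category) (F : functor C E)
  (D : functor J C) (c : cocone D) (i j : J) (u : hom i j) :
  compm (fmap F (leg c j)) (fmap (fcomp F D) u) = fmap F (leg c i).
Proof. by rewrite /= -fmap_comp leg_natural. Qed.

Definition map_cocone (J C E : category) (F : functor C E) (D : functor J C)
    (c : cocone D) : cocone (fcomp F D) :=
  @Cocone J E (fcomp F D) (F (apex c)) (fun j => fmap F (leg c j))
    (@map_cocone_natural J C E F D c).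

(* Every family of fewer than aleph_1 elements has an upper bound; taking
   A = set0, J is in particular nonempty. *)
Definition aleph1_directed (d : Order.disp_t) (J : porderType d) : Prop :=
  forall A : set J, countable A -> exists m : J, forall i, A i -> (i <= m)%O.

Definition preserves_aleph1_directed_colimits (C E : category)
    (F : functor C E) : Prop :=
  forall (d : Order.disp_t) (J : porderType d), aleph1_directed J ->
  forall (D : functor (poset_cat J) C) (c : cocone D),
    is_colimit c -> is_colimit (map_cocone F c).

Lemma hom_to_fmap1 (C : category) (X Y : op C) :
  (fun g : hom (c := C) Y X => compm g (idm (c := C) Y)) = idm (c := type_cat) _.
Proof. by apply/funext => g; rewrite compm_idr. Qed.

Lemma hom_to_fmap_comp (C : category) (X : C) (x y z : op C)
  (g : hom y z) (f : hom x y) :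
  (fun h : hom (c := C) x X => compm h (compm (c := op C) g f : hom (c := C) z x)) =
  (fun h : hom (c := C) x X => compm (compm h (f : hom (c := C) y x)) g).
Proof. by apply/funext => h; rewrite compmA. Qed.

(* The contravariant representable functor hom(-, X) : C^op -> Set. *)
Definition hom_to (C : category) (X : C) : functor (op C) type_cat :=
  @Functor (op C) type_cat (fun Y => hom (c := C) Y X)
    (fun Y Z f g => compm (c := C) g f)
    (fun Y => @hom_to_fmap1 C X Y) (@hom_to_fmap_comp C X).

Definition aleph1_copresentable (C : category) (X : C) : Prop :=
  preserves_aleph1_directed_colimits (hom_to X).

Record pocompact := PoCompact {
  po_disp : Order.disp_t;
  po_space :> POrderedTopological.type po_disp;
  po_compact : compact [set: po_space];
  po_closed : closed [set xy : po_space * po_space | (xy.1 <= xy.2)%O] }.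

Record pohom (X Y : pocompact) := PoHom {
  pofun :> X -> Y;
  pohom_monotone : {homo pofun : x y / (x <= y)%O};
  pohom_continuous : continuous pofun }.

Lemma pohom_eq (X Y : pocompact) (f g : pohom X Y) : pofun f = pofun g -> f = g.
Proof.
case: f g => [f fm fc] [g gm gc] /= fg; rewrite fg in fm fc *.
by rewrite (Prop_irrelevance fm gm) (Prop_irrelevance fc gc).
Qed.

Definition poid (X : pocompact) : pohom X X :=
  @PoHom X X id (fun x y xy => xy) (fun x => cvg_id).

Lemma pocomp_continuous (X Y Z : pocompact) (g : pohom Y Z) (f : pohom X Y) :
  continuous (g \o f).
Proof.
by move=> x; apply: continuous_comp; apply: pohom_continuous.
Qed.

Definition pocomp (X Y Z : pocompact) (g : pohom Y Z) (f : pohom X Y) :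
    pohom X Z :=
  @PoHom X Z (g \o f)
    (fun x y xy => pohom_monotone g (pohom_monotone f xy))
    (@pocomp_continuous X Y Z g f).

Definition PosComp : category :=
  @Category pocompact pohom poid pocomp
    (fun X Y f => @pohom_eq X Y (pocomp (poid Y) f) f erefl)
    (fun X Y f => @pohom_eq X Y (pocomp f (poid X)) f erefl)
    (fun X Y Z W h g f => @pohom_eq X W (pocomp h (pocomp g f))
                            (pocomp (pocomp h g) f) erefl).

(* Neither symmetric nor separated, and bounded by 1. *)
Record is_metric (R : realType) (X : Type) (a : X -> X -> R) : Prop := IsMetric {
  metric_range : forall x y, 0 <= a x y <= 1;
  metric_refl : forall x, a x x = 0;
  metric_triangle : forall x y z, a x z <= Num.min 1 (a x y + a y z) }.

Definition symmetrisation (R : realType) (X : Type) (a : X -> X -> R) (x y : X)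
  : R := Num.max (a x y) (a y x).

Definition induces_order (R : realType) (d : Order.disp_t) (X : porderType d)
    (a : X -> X -> R) : Prop :=
  forall x y : X, (x <= y)%O <-> a x y = 0.

Definition induces_topology (R : realType) (X : topologicalType)
    (a : X -> X -> R) : Prop :=
  forall U : set X, open U <->
    forall x, U x ->
      exists2 e : R, 0 < e & [set y | symmetrisation a x y < e] `<=` U.

Definition metrisable (R : realType) (X : pocompact) : Prop :=
  exists a : X -> X -> R,
    [/\ is_metric a, induces_order a & induces_topology a].

(* Main.v *)
From HB Require Import structures.
Require Import Defs.
From mathcomp Require Import all_boot all_order all_algebra.
From mathcomp Require Import all_classical all_reals all_analysis.
From mathcomp Require Import lra.

(** A compact ordered space X has enough monotone continuous maps to the reals
    to recover both its order and its topology; the theorem says that when X is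
    copresentable, countably many of them suffice, and a countable family yields
    a metric by the usual weighted supremum.

    For a countable family A of monotone continuous maps X -> R, let X_A be the
    image of X in the power R^A, with the pointwise order and the product
    topology. The X_A form a codirected diagram indexed by countable families
    under inclusion, and that index poset is aleph_1-directed because a countable
    union of countable sets is countable. Moreover X is the limit of the X_A: the
    maps X -> X_A are onto, they jointly reflect the order, and a compactness
    argument shows that such a cone is a limit ([surjective_cone_limit]). That
    they reflect the order is the ordered Urysohn lemma of Nachbin
    ([monotone_separation]): if x is not below y, some monotone continuous f has
    f y < f x.

    If X is copresentable, hom(-, X) turns this limit into a colimit of sets, so
    the identity of X factors as s \o q through some q : X -> X_A. As s is
    monotone, q reflects the order, which means that the countable family A alone
    detects the order of X ([copresentable_separating_family]). Enumerating A as
    g_0, g_1, ..., the supremum over n of min (1/(n+1)) (max 0 (g_n x - g_n y))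
    is a metric inducing the order, and it induces the topology because X is
    compact ([metrisable_of_separating_sequence]). *)

Set Implicit Arguments.
Unset Strict Implicit.
Unset Printing Implicit Defensive.

Import Order.TTheory GRing.Theory Num.Theory.
Import numFieldNormedType.Exports.
Local Open Scope classical_set_scope.
Local Open Scope ring_scope.

(** * Compactness and closed sets in ordered compact spaces *)

Lemma codirected_closed_inter (T : topologicalType) (I : Type)
    (C : I -> set T) :
  compact [set: T] -> inhabited I ->
  (forall i j, exists k, C k `<=` C i `&` C j) ->
  (forall i, closed (C i)) -> (forall i, C i !=set0) ->
  exists x, forall i, C i x.
Proof.
move=> Tc [i0] Cdir Ccl C0.
have FF : ProperFilter (filter_from [set: I] C).
  apply: filter_from_proper => //; apply: filter_from_filter => //.
    by exists i0.
  by move=> i j _ _; have [k] := Cdir i j; exists k.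
have [] := Tc _ FF; first by exists i0.
move=> x [_ clx]; exists x => i; apply: Ccl => B Bx.
by apply: clx => //; exists i.
Qed.

Section OrderedSpace.
Variable X : pocompact.
Implicit Types (A B : set X) (x y : X).

Definition downset A := forall x y, (x <= y)%O -> A y -> A x.
Definition up_closure A := [set y | exists2 x, A x & (x <= y)%O].
Definition down_closure A := [set x | exists2 y, A y & (x <= y)%O].

(** The diagonal is the intersection of two closed sets: the order and its
    converse. *)
Lemma pocompact_hausdorff : hausdorff_space X.
Proof.
move=> x y xy; apply: le_anti; apply/andP; split.
  apply: (@po_closed X (x, y)) => B [[U V] [/= Ux Vy] UV].
  have [z [Uz Vz]] := xy _ _ Ux Vy.
  by exists (z, z); split => //=; apply: UV.
apply: (@po_closed X (y, x)) => B [[U V] [/= Uy Vx] UV].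
have [z [Uz Vz]] := xy _ _ Vx Uy.
by exists (z, z); split => //=; apply: UV.
Qed.

Lemma pocompact_closed_set1 x : closed [set x].
Proof.
apply: accessible_closed_set1; apply: hausdorff_accessible.
exact: pocompact_hausdorff.
Qed.

Lemma pocompact_closed_compact A : closed A -> compact A.
Proof. by move=> Acl; apply: (subclosed_compact Acl (@po_compact X)). Qed.

Lemma compact_image_closed (Y : topologicalType) (f : Y -> X) (K : set Y) :
  continuous f -> compact K -> closed (f @` K).
Proof.
move=> fc Kc; apply: compact_closed; first exact: pocompact_hausdorff.
by apply: continuous_compact => //; exact: continuous_subspaceT.
Qed.

Lemma order_restr_compact A B : closed A -> closed B ->
  compact ((A `*` B) `&` [set xy : X * X | (xy.1 <= xy.2)%O]).
Proof.
move=> Acl Bcl; apply: compact_closedI; last exact: po_closed.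
by apply: compact_setX; apply: pocompact_closed_compact.
Qed.

(** The up-closure of A is the projection of the compact set of pairs x <= y
    with x in A. *)
Lemma up_closure_closed A : closed A -> closed (up_closure A).
Proof.
move=> Acl.
suff -> : up_closure A =
    snd @` ((A `*` setT) `&` [set xy : X * X | (xy.1 <= xy.2)%O]).
  apply: compact_image_closed; first by move=> ?; exact: cvg_snd.
  exact: order_restr_compact.
apply/seteqP; split => [y [x Ax xy]|y [[x z] [[/= Ax _] xz] <-]].
  by exists (x, y).
by exists x.
Qed.

Lemma down_closure_closed A : closed A -> closed (down_closure A).
Proof.
move=> Acl.
suff -> : down_closure A =
    fst @` ((setT `*` A) `&` [set xy : X * X | (xy.1 <= xy.2)%O]).
  apply: compact_image_closed; first by move=> ?; exact: cvg_fst.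
  exact: order_restr_compact.
apply/seteqP; split => [x [y Ay xy]|x [[z y] [[/= _ Ay] zy] <-]].
  by exists (x, y).
by exists y.
Qed.

Lemma downset_setC_up_closure A : downset (~` up_closure A).
Proof.
by move=> x y xy Ny [z Az zx]; apply: Ny; exists z => //; apply: le_trans xy.
Qed.

Lemma downset_down_closure A : downset (down_closure A).
Proof.
by move=> x y xy [z Az yz]; exists z => //; apply: le_trans yz.
Qed.

(** * The ordered Urysohn lemma *)

(** The ordered analogue of saying that the closure of A lies in the interior
    of B. *)
Definition well_inside A B :=
  exists C U, [/\ closed C, downset C, open U & downset U] /\
              [/\ A `<=` C, C `<=` U & U `<=` B].

Lemma well_inside_sub A B : well_inside A B -> A `<=` B.
Proof. by move=> [C [U [_ [AC CU UB]]]] x /AC/CU/UB. Qed.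

(** Normality of the space gives an open W with C inside W and the closure of W
    inside U. Ordering it costs nothing: the largest downset inside W is open
    and still contains C, the down-closure of the closure of W is closed and
    still lies in U, because C and U are downsets. *)
Lemma well_inside_interpolation A B : well_inside A B ->
  exists M, [/\ downset M, well_inside A M & well_inside M B].
Proof.
move=> [C [U [[Ccl Cdown Uop Udown] [AC CU UB]]]].
have UC : set_nbhs C U.
  by move=> x Cx; apply: open_nbhs_nbhs; split => //; exact: CU.
have [V /set_nbhsP [W [Wop CW WV]] VU] :=
  compact_normal pocompact_hausdorff (@po_compact X) Ccl UC.
have WclU : closure W `<=` U.
  by move=> x Wx; apply: VU; apply: closureS Wx.
have dWcl : closed (down_closure (closure W)).
  by apply: down_closure_closed; exact: closed_closure.
exists (down_closure (closure W)); split; first exact: downset_down_closure.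
  exists C, (~` up_closure (~` W)); split; split => //.
  - by apply: closed_openC; apply: up_closure_closed; exact: open_closedC.
  - exact: downset_setC_up_closure.
  - by move=> x Cx [z Wz zx]; apply: Wz; apply: CW; exact: Cdown Cx.
  - move=> x Nx; exists x => //; apply: subset_closure.
    by apply: contrapT => Wx; apply: Nx; exists x.
exists (down_closure (closure W)), U; split; split => //.
  exact: downset_down_closure.
by move=> x [y /WclU Uy xy]; exact: Udown Uy.
Qed.

Section DyadicScale.
Variables (A B : set X).
Hypotheses (Adown : downset A) (Bdown : downset B) (AB : well_inside A B).

Definition interpolant (P Q : set X) : set X :=
  xget setT [set M | [/\ downset M, well_inside P M & well_inside M Q]].

(** [dyadic_scale k i] is the downset attached to the dyadic number i / 2^k: A
    at 0, B at 1, the whole space from 2 on, and interpolants at the new odd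
    numerators of each level. *)
Fixpoint dyadic_scale (k i : nat) {struct k} : set X :=
  if k is k'.+1 then
    if odd i then interpolant (dyadic_scale k' i./2) (dyadic_scale k' i./2.+1)
    else dyadic_scale k' i./2
  else match i with 0 => A | 1 => B | _ => setT end.

Lemma interpolantP P Q : well_inside P Q ->
  [/\ downset (interpolant P Q), well_inside P (interpolant P Q)
    & well_inside (interpolant P Q) Q].
Proof.
move=> /well_inside_interpolation[M PMQ]; rewrite /interpolant.
by case: xgetP => [_ -> //|/(_ M)].
Qed.

Lemma well_insideT P : well_inside P setT.
Proof. by exists setT, setT; split; split => //; exact: openT. Qed.

Lemma dyadic_scale_well_inside k i :
  well_inside (dyadic_scale k i) (dyadic_scale k i.+1).
Proof.
elim: k i => [[|[|i]]|k IH i] /=.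
- exact: AB.
- exact: well_insideT.
- exact: well_insideT.
rewrite uphalf_half; have [_ ? ?] := interpolantP (IH i./2).
by case: (odd i).
Qed.

Lemma dyadic_scale_downset k i : downset (dyadic_scale k i).
Proof.
elim: k i => [[|[|i]]|k IH i] //=; case: ifP => // _.
by have [] := interpolantP (dyadic_scale_well_inside k i./2).
Qed.

Lemma dyadic_scale_mono k i j : (i <= j)%N ->
  dyadic_scale k i `<=` dyadic_scale k j.
Proof.
move=> /subnK <-; elim: (j - i)%N => // n IH; rewrite addSn.
apply: (subset_trans IH); apply: well_inside_sub.
exact: dyadic_scale_well_inside.
Qed.

Lemma dyadic_scale_refine k i l :
  dyadic_scale (l + k) (i * 2 ^ l) = dyadic_scale k i.
Proof.
elim: l => [|l IH]; first by rewrite muln1.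
rewrite addSn /= expnS mulnCA mul2n odd_double /= doubleK; exact: IH.
Qed.

Lemma dyadic_scale_le k i l j : (i * 2 ^ l <= j * 2 ^ k)%N ->
  dyadic_scale k i `<=` dyadic_scale l j.
Proof.
move=> le_ij; rewrite -(dyadic_scale_refine k i l).
rewrite -(dyadic_scale_refine l j k) addnC.
exact: dyadic_scale_mono.
Qed.

Lemma dyadic_scaleT k : dyadic_scale k (2 * 2 ^ k) = setT.
Proof. by rewrite -[k in dyadic_scale k]addn0 dyadic_scale_refine. Qed.

Variable R : realType.

Definition height_set x : set R :=
  [set r | exists k i, dyadic_scale k i x /\ r = i%:R / 2 ^+ k].

Definition height x : R := inf (height_set x).

Lemma height_set_has_inf x : has_inf (height_set x).
Proof.
split; first by exists 2, 0, 2; rewrite expr0 divr1.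
by exists 0 => _ [k [i [_ ->]]]; rewrite divr_ge0// exprn_ge0.
Qed.

Lemma height_ge0 x : 0 <= height x.
Proof.
apply: lb_le_inf; first by have [] := height_set_has_inf x.
by move=> _ [k [i [_ ->]]]; rewrite divr_ge0// exprn_ge0.
Qed.

Lemma height_le k i x : dyadic_scale k i x -> height x <= i%:R / 2 ^+ k.
Proof.
by move=> xki; apply: ge_inf; [have [] := height_set_has_inf x|exists k, i].
Qed.

Lemma height_ge k i x : ~ dyadic_scale k i x -> i%:R / 2 ^+ k <= height x.
Proof.
move=> Nx; apply: lb_le_inf; first by have [] := height_set_has_inf x.
move=> _ [l [j [xlj ->]]]; rewrite leNgt; apply/negP => lt_ji; apply: Nx.
apply: dyadic_scale_le xlj; apply: ltnW.
rewrite ltr_pdivrMr ?exprn_gt0// mulrAC ltr_pdivlMr ?exprn_gt0// in lt_ji.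
by rewrite -(ltr_nat R) !natrM !natrX.
Qed.

Lemma height_monotone x y : (x <= y)%O -> height x <= height y.
Proof.
move=> xy; apply: lb_le_inf; first by have [] := height_set_has_inf y.
move=> _ [k [i [yki ->]]]; apply: height_le.
exact: dyadic_scale_downset yki.
Qed.

(** At level k let n be the least index whose downset contains x. Consecutive
    downsets are separated by a closed and an open set, so near x one stays
    inside the downset of index n + 1 and outside that of index n - 2: the height
    varies there by at most 3 / 2^k. *)
Lemma height_continuous : continuous height.
Proof.
move=> x; apply/cvgrPdist_le => /= e e0.
have [k ke] : exists k : nat, 3 / 2 ^+ k <= e.
  have e3 : 0 < e / 3 by rewrite divr_gt0.
  have [k _ /(_ k (leqnn k))/= ke] := near_infty_natSinv_expn_lt (PosNum e3).
  exists k; rewrite mulrC -ler_pdivlMr// -[X in X <= _]mul1r; exact: ltW.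
have [n xn nmin] : exists2 n, dyadic_scale k n x &
    forall i, dyadic_scale k i x -> (n <= i)%N.
  have exn : exists n, `[< dyadic_scale k n x >].
    by exists (2 * 2 ^ k)%N; apply/asboolP; rewrite dyadic_scaleT.
  exists (ex_minn exn); case: ex_minnP => m /asboolP// _ mmin i xi.
  by apply: mmin; apply/asboolP.
have below : \forall y \near x, (n%:R - 2) / 2 ^+ k <= height y.
  have [n2|] := ltnP n 2.
    near=> y; apply: le_trans (height_ge0 y).
    by rewrite pmulr_lle0 ?invr_gt0 ?exprn_gt0// subr_le0 ler_nat ltnW.
  case: n nmin {xn} => [|[|n]]// nmin _.
  have [C [U [[Ccl _ _ _] [nC CU Un]]]] := dyadic_scale_well_inside k n.
  have NCx : (~` C) x by move=> /CU/Un /nmin; rewrite ltnn.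
  near=> y; have NCy : (~` C) y.
    by near: y; apply: open_nbhs_nbhs; split => //; exact: closed_openC.
  by rewrite -addn2 natrD addrK; apply: height_ge => /nC.
have above : \forall y \near x, height y <= (n%:R + 1) / 2 ^+ k.
  have [C [U [[_ _ Uop _] [nC CU Un]]]] := dyadic_scale_well_inside k n.
  near=> y; rewrite natr1; apply: height_le; apply: Un; near: y.
  by apply: open_nbhs_nbhs; split => //; exact/CU/nC.
have xlo := nbhs_singleton below; have xhi := nbhs_singleton above.
near=> y; apply: le_trans ke.
have ylo : (n%:R - 2) / 2 ^+ k <= height y by near: y.
have yhi : height y <= (n%:R + 1) / 2 ^+ k by near: y.
rewrite !mulrDl !mulNr !mul1r in xlo xhi ylo yhi.
rewrite ler_norml; apply/andP; split; lra.
Unshelve. all: by end_near. Qed.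

End DyadicScale.

Lemma monotone_separation (R : realType) x y : ~ (x <= y)%O ->
  exists f : X -> R,
    [/\ continuous f, {homo f : u v / (u <= v)%O >-> u <= v} & f y < f x].
Proof.
move=> Nxy.
pose A := down_closure [set y]; pose B := ~` up_closure [set x].
have Adown : downset A by exact: downset_down_closure.
have Bdown : downset B by exact: downset_setC_up_closure.
have Acl : closed A.
  by apply: down_closure_closed; exact: pocompact_closed_set1.
have Bop : open B.
  by apply: closed_openC; apply: up_closure_closed; exact: pocompact_closed_set1.
have AB : well_inside A B.
  exists A, B; split; split => // z [_ -> zy] [_ -> xz].
  by apply: Nxy; exact: le_trans zy.
exists (@height A B R); split.
- exact: height_continuous.
- by move=> u v; exact: height_monotone.
- have y0 : height A B R y <= 0%:R / 2 ^+ 0 by apply: height_le; exists y.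
  have x1 : 1%:R / 2 ^+ 0 <= height A B R x.
    by apply: height_ge => //= Bx; apply: Bx; exists x.
  rewrite mul0r in y0; rewrite divr1 in x1.
  exact: le_lt_trans y0 (lt_le_trans ltr01 x1).
Qed.

End OrderedSpace.

(** * Metrisation by a separating sequence *)

Section Metrisation.
Variables (R : realType) (X : pocompact) (g : nat -> X -> R).
Hypothesis g_continuous : forall n, continuous (g n).
Hypothesis g_monotone : forall n, {homo g n : x y / (x <= y)%O >-> x <= y}.
Hypothesis g_reflect : forall x y, (forall n, g n x <= g n y) -> (x <= y)%O.
Implicit Types x y z : X.

(** The truncation at 1/(n+1) is what makes the supremum of the gaps depend, up
    to any given error, on finitely many of the maps only. *)
Definition gap n x y : R := Num.min n.+1%:R^-1 (Num.max 0 (g n x - g n y)).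

Definition gap_metric x y : R := sup (range (fun n => gap n x y)).

Lemma gap_ge0 n x y : 0 <= gap n x y.
Proof. by rewrite le_min invr_ge0 ler0n le_max lexx. Qed.

Lemma gap_le_weight n x y : gap n x y <= n.+1%:R^-1.
Proof. by rewrite ge_min lexx. Qed.

Lemma gap_le1 n x y : gap n x y <= 1.
Proof.
by apply: le_trans (gap_le_weight n x y) _; rewrite invf_le1 ?ler1n.
Qed.

Lemma gap_triangle n x y z : gap n x z <= gap n x y + gap n y z.
Proof.
have : 0 < n.+1%:R^-1 :> R by rewrite invr_gt0.
rewrite /gap; move: (n.+1%:R^-1) => w w0.
move: (g n x) (g n y) (g n z) => a b c.
by rewrite /Num.min /Num.max; do !case: ifPn; lra.
Qed.

Lemma gap_eq0 n x y : (gap n x y <= 0) = (g n x <= g n y).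
Proof. by rewrite ge_min invr_le0 lern0 /= ge_max lexx subr_le0. Qed.

Lemma gap_continuous n x : continuous (gap n x).
Proof.
apply: (min_fun_continuous (f := fun=> _)).
  by move=> ?; exact: cst_continuous.
apply: (max_fun_continuous (f := fun=> _)).
  by move=> ?; exact: cst_continuous.
by move=> y; apply: continuousB; [exact: cst_continuous|exact: g_continuous].
Qed.

Lemma gap_continuous_l n y : continuous (gap n ^~ y).
Proof.
apply: (min_fun_continuous (f := fun=> _)).
  by move=> ?; exact: cst_continuous.
apply: (max_fun_continuous (f := fun=> _)).
  by move=> ?; exact: cst_continuous.
by move=> x; apply: continuousB; [exact: g_continuous|exact: cst_continuous].
Qed.

Lemma gap_metric_leP x y e :
  gap_metric x y <= e <-> forall n, gap n x y <= e.
Proof.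
split => [de n|ge].
  apply: le_trans de; apply: ub_le_sup; last by exists n.
  by exists 1 => _ [m _ <-]; exact: gap_le1.
by apply: ge_sup => [|_ [n _ <-]//]; exists (gap 0 x y), 0.
Qed.

Lemma gap_le_metric n x y : gap n x y <= gap_metric x y.
Proof. by move: n; apply/gap_metric_leP. Qed.

Lemma gap_metric_is_metric : is_metric gap_metric.
Proof.
split => [x y|x|x y z].
- apply/andP; split.
    exact: le_trans (gap_ge0 0 x y) (gap_le_metric _ _ _).
  by apply/gap_metric_leP => n; exact: gap_le1.
- apply: le_anti; apply/andP; split.
    by apply/gap_metric_leP => n; rewrite gap_eq0.
  exact: le_trans (gap_ge0 0 x x) (gap_le_metric _ _ _).
- rewrite le_min; apply/andP; split.
    by apply/gap_metric_leP => n; exact: gap_le1.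
  apply/gap_metric_leP => n; apply: le_trans (gap_triangle n x y z) _.
  by apply: lerD; exact: gap_le_metric.
Qed.

Lemma gap_metric_le0 x y : gap_metric x y <= 0 -> (x <= y)%O.
Proof.
by move=> /gap_metric_leP xy; apply: g_reflect => n; rewrite -gap_eq0.
Qed.

Lemma gap_metric_order : induces_order gap_metric.
Proof.
move=> x y; split => [xy|xy]; last by apply: gap_metric_le0; rewrite xy.
apply: le_anti; have /andP[-> _] := metric_range gap_metric_is_metric x y.
by rewrite andbT; apply/gap_metric_leP => n; rewrite gap_eq0; exact: g_monotone.
Qed.

Lemma gap_metric_ball_nbhs x e : 0 < e ->
  nbhs x [set y | symmetrisation gap_metric x y < e].
Proof.
move=> e0; have e20 : 0 < e / 2 by rewrite divr_gt0.
have [N _ /(_ N (leqnn N))/= Ne] := near_infty_natSinv_lt (PosNum e20).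
have gN : \forall y \near x, forall n : 'I_N, `|g n x - g n y| < e / 2.
  apply: filter_forall => n.
  exact: (@cvgr_dist_lt _ _ _ _ _ _ _ (@g_continuous n x)).
near=> y => /=.
have gy : forall n : 'I_N, `|g n x - g n y| < e / 2 by near: y.
have gap_small n : gap n x y <= e / 2 /\ gap n y x <= e / 2.
  have [nN|Nn] := ltnP n N.
    have := gy (Ordinal nN); rewrite /= ltr_norml => /andP[g1 g2].
    by split; rewrite ge_min ge_max (ltW e20); apply/orP; right => /=; lra.
  have wn : n.+1%:R^-1 <= e / 2 :> R.
    by apply: le_trans (ltW Ne); rewrite lef_pV2 ?posrE// ler_nat.
  by split; apply: le_trans wn; exact: gap_le_weight.
rewrite gt_max; apply/andP.
split; (apply: (@le_lt_trans _ _ (e / 2)); last lra);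
  by apply/gap_metric_leP => n; have [] := gap_small n.
Unshelve. all: by end_near. Qed.

(** Balls are neighbourhoods, so sets that are open for the metric are open. For
    the converse, suppose that no ball around x lies in the open set U. Then the
    points outside U at distance at most 1/(k+1) from x form a decreasing
    sequence of nonempty closed sets; a common point of them would be at distance
    0 from x, hence equal to x, which lies in U. *)
Lemma gap_metric_topology : induces_topology gap_metric.
Proof.
move=> U; split => [Uop x Ux|ballU]; last first.
  rewrite openE => x /ballU[e e0 eU].
  by apply: filterS eU _; exact: gap_metric_ball_nbhs.
apply: contrapT => NU.
pose C k := [set y | ~ U y /\ symmetrisation gap_metric x y <= k.+1%:R^-1].
have [|||k|y Cy] := codirected_closed_inter (C := C) (@po_compact X).
- exact: (inhabits 0).
- move=> i j; exists (maxn i j) => y [NUy ye]; split; split => //;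
    apply: le_trans ye _; rewrite lef_pV2 ?posrE// ler_nat ltnS.
    exact: leq_maxl.
  exact: leq_maxr.
- move=> k.
  have -> : C k = ~` U `&` \bigcap_(n in [set: nat])
      ([set y | gap n x y <= k.+1%:R^-1] `&` [set y | gap n y x <= k.+1%:R^-1]).
    apply/seteqP; split => [y [NUy]|y [NUy gy]].
      rewrite /symmetrisation ge_max.
      move=> /andP[/gap_metric_leP xy /gap_metric_leP yx].
      split; first by [].
      by move=> n _; split; [exact: xy|exact: yx].
    split => //; rewrite /symmetrisation ge_max; apply/andP.
    by split; apply/gap_metric_leP => n; have [] := gy n Logic.I.
  apply: closedI; first exact: open_closedC.
  apply: closed_bigI => n _; apply: closedI.
    apply: (@closed_comp _ _ (gap n x) [set r | r <= k.+1%:R^-1]).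
      by move=> y _; exact: gap_continuous.
    exact: closed_le.
  apply: (@closed_comp _ _ (gap n ^~ x) [set r | r <= k.+1%:R^-1]).
    by move=> y _; exact: gap_continuous_l.
  exact: closed_le.
- apply: contrapT => Ck; apply: NU.
  exists k.+1%:R^-1; first by rewrite invr_gt0.
  move=> y /= xy; apply: contrapT => NUy; apply: Ck; exists y; split => //.
  exact: ltW.
have xy0 : symmetrisation gap_metric x y <= 0.
  apply/ler_addgt0Pl => e e0; rewrite addr0.
  have [N _ /(_ N (leqnn N))/= Ne] := near_infty_natSinv_lt (PosNum e0).
  by have [_ yN] := Cy N; exact: le_trans yN (ltW Ne).
have [NUy _] := Cy 0; apply: NUy.
move: xy0; rewrite ge_max => /andP[xy yx].
by have -> : y = x; first apply: le_anti; rewrite ?gap_metric_le0.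
Qed.

Lemma metrisable_of_separating_sequence : metrisable R X.
Proof.
exists gap_metric; split; first exact: gap_metric_is_metric.
  exact: gap_metric_order.
exact: gap_metric_topology.
Qed.

End Metrisation.

Lemma metrisable_of_separating_family (R : realType) (X : pocompact)
    (A : set (X -> R)) :
  countable A -> (forall f, A f -> continuous f) ->
  (forall f, A f -> {homo f : x y / (x <= y)%O >-> x <= y}) ->
  (forall x y, (forall f, A f -> f x <= f y) -> (x <= y)%O) ->
  metrisable R X.
Proof.
move=> /countable_injP[i i_inj] Acont Amono Areflect.
(* A may be empty or finite: the numbers that code no member of A are sent to
   the constant map 0, which separates nothing and is harmless. *)
pose g n : X -> R := xget (fun=> 0) [set f | A f /\ i f = n].
have gP n : A (g n) \/ g n = fun=> 0.
  by rewrite /g; case: xgetP => [f _ []|]; [left|right].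
apply: (@metrisable_of_separating_sequence R X g).
- move=> n; have [/Acont//|->] := gP n.
  by move=> x; exact: cst_continuous.
- by move=> n; have [/Amono//|->] := gP n.
- move=> x y gxy; apply: Areflect => f Af.
  suff <- : g (i f) = f by exact: gxy.
  rewrite /g; case: xgetP => [h _ [Ah hf]|/(_ f) []//].
  by apply: i_inj => //; exact: mem_set.
Qed.

(** * Colimits of sets and limits of ordered compact spaces *)

(** If the union of the images of the legs were a proper subset of the colimit,
    its characteristic predicate and the constantly true one would be two
    distinct maps to Prop that agree on every leg. *)
Lemma type_colimit_jointly_surjective (J : category)
    (D : functor J type_cat) (c : cocone D) :
  is_colimit c -> forall t : apex c, exists j (s : D j), leg c j s = t.
Proof.
move=> colim t.
pose allTrue : cocone D := @Cocone J type_cat D Prop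
  (fun j => fun _ : D j => True) (fun i j u => erefl).
have [u [_ u_uniq]] := colim allTrue.
have uT : u = (fun=> True) by apply: u_uniq => j; apply/funext.
have : u = (fun t : apex c => exists j (s : D j), leg c j s = t).
  apply: u_uniq => j; apply/funext => s /=.
  by apply/propext; split => // _; exists j, s.
by rewrite uT => /(congr1 (fun v => v t)) <-.
Qed.

Section SurjectiveCone.
Variables (d : Order.disp_t) (J : porderType d).
Variable D : functor (poset_cat J) (op PosComp).
Hypothesis J_directed : forall i j : J, exists k, (i <= k)%O /\ (j <= k)%O.
Hypothesis J_inhabited : inhabited J.

(** A cocone in the opposite category is a cone of spaces: its legs go from the
    apex to the objects of the diagram. *)
Definition vertex (c : cocone D) : pocompact := apex c.
Definition cone_map (c : cocone D) (j : J) : pohom (vertex c) (D j) := leg c j.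

Lemma cone_map_compatible (c c' : cocone D) i j (x : vertex c)
    (y : vertex c') : (i <= j)%O ->
  cone_map c j x = cone_map c' j y -> cone_map c i x = cone_map c' i y.
Proof.
move=> ij xy; rewrite /cone_map.
rewrite -(@leg_natural _ _ _ c i j ij) -(@leg_natural _ _ _ c' i j ij) /=.
by congr (pofun _ _).
Qed.

Variable c : cocone D.
Hypothesis cone_surj : forall j (z : (D j : pocompact)),
  exists x, cone_map c j x = z.
Hypothesis cone_reflect : forall x y : vertex c,
  (forall j, (cone_map c j x <= cone_map c j y)%O) -> (x <= y)%O.

Lemma cone_map_inj x y : (forall j, cone_map c j x = cone_map c j y) -> x = y.
Proof.
by move=> xy; apply: le_anti; rewrite !cone_reflect// => j; rewrite xy.
Qed.

(** The fibres over the compatible family given by z meet C in a codirected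
    family of nonempty closed sets. With C the whole space this yields the points
    of the mediating map, with C arbitrary its continuity. *)
Lemma cone_point (c' : cocone D) (z : vertex c') (C : set (vertex c)) :
  closed C -> (forall j, (cone_map c j @` C) (cone_map c' j z)) ->
  exists2 x, C x & forall j, cone_map c j x = cone_map c' j z.
Proof.
move=> Ccl Cz.
pose F j := C `&` cone_map c j @^-1` [set cone_map c' j z].
have [|j|j|x Fx] := codirected_closed_inter (C := F)
  (@po_compact (vertex c)) J_inhabited.
- move=> i j; have [k [ik jk]] := J_directed i j.
  exists k => x [Cx /= xk].
  by split; split => //; exact: cone_map_compatible xk.
- apply: closedI => //; apply: closed_comp; last exact: pocompact_closed_set1.
  by move=> x _; exact: pohom_continuous.
- by have [x Cx xz] := Cz j; exists x.
case: J_inhabited => j0.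
by exists x; [have [] := Fx j0|move=> j; have [] := Fx j].
Qed.

(** The mediating map u sends y to the unique point with the same images as y.
    It is continuous since the preimage of a closed C is the intersection of the
    preimages in Y of the images of C, which are closed by compactness. *)
Lemma surjective_cone_limit : is_colimit c.
Proof.
move=> c'; pose Y := vertex c'.
have lift (y : Y) : exists x, forall j, cone_map c j x = cone_map c' j y.
  have [||x _ xy] := @cone_point c' y setT; first exact: closedT.
    by move=> j; have [x xy] := cone_surj (cone_map c' j y); exists x.
  by exists x.
pose u y := projT1 (cid (lift y)).
have uP y j : cone_map c j (u y) = cone_map c' j y by rewrite /u; case: cid.
have u_mono : {homo u : x y / (x <= y)%O}.
  move=> x y xy; apply: cone_reflect => j; rewrite !uP.
  exact: pohom_monotone.
have u_cont : continuous u.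
  apply/continuous_closedP => C Ccl.
  have -> : u @^-1` C =
      \bigcap_(j in [set: J]) (cone_map c' j @^-1` (cone_map c j @` C)).
    apply/seteqP; split => [y Cuy j _|y yC]; first by exists (u y).
    have [|x Cx xy] := @cone_point c' y C Ccl; first by move=> j; exact: yC.
    rewrite /preimage /=; have -> // : u y = x.
    by apply: cone_map_inj => j; rewrite uP xy.
  apply: closed_bigI => j _; apply: closed_comp.
    by move=> y _; exact: pohom_continuous.
  apply: compact_image_closed; first exact: pohom_continuous.
  exact: pocompact_closed_compact.
exists (PoHom u_mono u_cont); split.
  by move=> j; apply: pohom_eq; apply/funext => y; exact: uP.
move=> v vP; apply: pohom_eq; apply/funext => y; apply: cone_map_inj => j.
by rewrite /= uP /cone_map -vP.
Qed.

End SurjectiveCone.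

(** * Compact images in powers of the reals *)

Section PointwiseOrder.
Variables (I : eqType) (R : realType) (K : set {ptws I -> R}).

Definition ptws_subspace : Type := set_type K.
HB.instance Definition _ := Topological.copy ptws_subspace (set_type K).

Implicit Types g h : ptws_subspace.

Definition ptws_le g h := `[< forall i, val g i <= val h i >].

Lemma ptws_leP g h : reflect (forall i, val g i <= val h i) (ptws_le g h).
Proof. exact: asboolP. Qed.

Lemma ptws_le_refl : reflexive ptws_le.
Proof. by move=> g; apply/ptws_leP. Qed.

Lemma ptws_le_anti : antisymmetric ptws_le.
Proof.
move=> g h /andP[/ptws_leP gh /ptws_leP hg]; apply: val_inj; apply/funext => i.
by apply: le_anti; rewrite gh hg.
Qed.

Lemma ptws_le_trans : transitive ptws_le.
Proof.
move=> h g k /ptws_leP gh /ptws_leP hk; apply/ptws_leP => i.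
exact: le_trans (hk i).
Qed.

HB.instance Definition _ := Order.Le_isPOrder.Build ring_display ptws_subspace
  ptws_le_refl ptws_le_anti ptws_le_trans.

Lemma ptws_coord_continuous i :
  continuous (fun g : ptws_subspace => val g i : R).
Proof.
rewrite -set_valE => g.
apply: (@continuous_comp _ {ptws I -> R} R set_val (proj i)).
  exact: initial_continuous.
exact: proj_continuous.
Qed.

Lemma ptws_subspace_continuous (Y : topologicalType) (f : Y -> ptws_subspace) :
  (forall i, continuous (fun y => val (f y) i : R)) -> continuous f.
Proof.
rewrite -set_valE => fc.
apply: (@continuous_comp_initial _ Y {ptws I -> R} set_val) => y.
apply/cvg_sup => i; move: y.
apply/(@continuousP _ (initial_topology (fun g : I -> R => g i))) => _ [B Bop <-].
by apply: (@open_comp _ _ (fun y => set_val (f y) i : R)) => // + _; exact: fc.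
Qed.

Lemma ptws_order_closed :
  closed [set gh : ptws_subspace * ptws_subspace | (gh.1 <= gh.2)%O].
Proof.
have -> : [set gh : ptws_subspace * ptws_subspace | (gh.1 <= gh.2)%O] =
    \bigcap_(i in [set: I])
      ((fun gh : ptws_subspace * ptws_subspace =>
         val gh.2 i - val gh.1 i) @^-1` [set r : R | 0 <= r]).
  apply/seteqP; split => [[g h] /ptws_leP gh i _|[g h] gh] /=.
    by rewrite subr_ge0; exact: gh.
  by apply/ptws_leP => i; rewrite -subr_ge0; exact: gh.
apply: closed_bigI => i _; apply: closed_comp; last exact: closed_ge.
move=> [g h] _; apply: continuousB.
  apply: (@continuous_comp _ _ _ snd (fun g : ptws_subspace => val g i)).
    exact: cvg_snd.
  exact: ptws_coord_continuous.
apply: (@continuous_comp _ _ _ fst (fun g : ptws_subspace => val g i)).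
  exact: cvg_fst.
exact: ptws_coord_continuous.
Qed.

End PointwiseOrder.

Section Image.
Variables (R : realType) (X : pocompact) (I : eqType) (e : X -> {ptws I -> R}).
Hypothesis e_continuous : forall i, continuous (fun x => e x i : R).

Definition corestriction (x : X) : ptws_subspace (range e) :=
  SigSub (mem_set (imageT e x)).

Lemma corestriction_continuous : continuous corestriction.
Proof. exact: ptws_subspace_continuous. Qed.

Lemma corestriction_surj g : exists x, corestriction x = g.
Proof.
case: g => g gP; have [x _ xg] := set_mem gP.
by exists x; apply: val_inj.
Qed.

Lemma ptws_image_compact : compact [set: ptws_subspace (range e)].
Proof.
have <- : corestriction @` setT = setT.
  apply/seteqP; split => // g _; have [x <-] := corestriction_surj g.
  by exists x.
apply: continuous_compact; last exact: po_compact.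
by apply: continuous_subspaceT; exact: corestriction_continuous.
Qed.

Definition ptws_image : pocompact :=
  PoCompact ptws_image_compact (@ptws_order_closed I R (range e)).

End Image.

(** * The diagram of countably separated quotients *)

Section CountableQuotients.
Variables (R : realType) (X : pocompact).

Record countable_family := CountableFamily {
  members : set (X -> R);
  members_countable : countable members;
  members_continuous : forall f, members f -> continuous f;
  members_monotone : forall f, members f ->
    {homo f : x y / (x <= y)%O >-> x <= y} }.

Implicit Types A B C : countable_family.

HB.instance Definition _ := gen_eqMixin countable_family.
HB.instance Definition _ := gen_choiceMixin countable_family.

Definition family_le A B := `[< members A `<=` members B >].

Lemma family_le_refl : reflexive family_le.
Proof. by move=> A; apply/asboolP. Qed.

Lemma family_le_anti : antisymmetric family_le.
Proof.
move=> [A ? ? ?] [B ? ? ?] /andP[/asboolP AB /asboolP BA].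
have E : A = B by apply/seteqP.
by subst B; congr CountableFamily; exact: Prop_irrelevance.
Qed.

Lemma family_le_trans : transitive family_le.
Proof.
by move=> B A C /asboolP AB /asboolP BC; apply/asboolP; exact: subset_trans BC.
Qed.

HB.instance Definition _ := Order.Le_isPOrder.Build Order.default_display
  countable_family family_le_refl family_le_anti family_le_trans.

Lemma family_leP A B : reflect (members A `<=` members B) (A <= B)%O.
Proof. exact: asboolP. Qed.

Lemma countable_family_directed : aleph1_directed countable_family.
Proof.
move=> F Fc.
pose U := \bigcup_(A in F) members A.
have Uc : countable U.
  by apply: bigcup_countable => // A _; exact: members_countable.
have Ucont f : U f -> continuous f by move=> [A _ /members_continuous].
have Umono f : U f -> {homo f : x y / (x <= y)%O >-> x <= y}.
  by move=> [A _ /members_monotone].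
exists (CountableFamily Uc Ucont Umono) => A FA.
by apply/family_leP => f Af; exists A.
Qed.

(** The coordinates outside A are set to 0 rather than dropped, so that all the
    quotients live in one power of R and no index type depends on A. *)
Definition mask (A : set (X -> R)) (h : (X -> R) -> R) (f : X -> R) : R :=
  if f \in A then h f else 0.

Definition masked_eval A (x : X) : {ptws (X -> R) -> R} :=
  mask (members A) (fun f => f x).

Lemma masked_eval_continuous A f : continuous (fun x => masked_eval A x f : R).
Proof.
rewrite /masked_eval /mask; have [/set_mem fA|_] := boolP (f \in members A).
  exact: members_continuous fA.
by move=> x; exact: cst_continuous.
Qed.

Definition quotient_space A : pocompact :=
  ptws_image (@masked_eval_continuous A).

Definition quotient_fun A : X -> quotient_space A :=
  corestriction (masked_eval A).

Lemma quotient_fun_le A x y : (quotient_fun A x <= quotient_fun A y)%O <->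
  forall f, members A f -> f x <= f y.
Proof.
split => [/ptws_leP xy f fA|xy].
  have := xy f; rewrite /= /masked_eval /mask.
  by rewrite (mem_set fA).
apply/ptws_leP => f; rewrite /= /masked_eval /mask.
by case: ifPn => // /set_mem /xy.
Qed.

Lemma quotient_fun_monotone A : {homo quotient_fun A : x y / (x <= y)%O}.
Proof.
move=> x y xy; apply/quotient_fun_le => f fA.
exact: members_monotone fA _ _ xy.
Qed.

Lemma quotient_fun_continuous A : continuous (quotient_fun A).
Proof. by apply: corestriction_continuous; exact: masked_eval_continuous. Qed.

Definition quotient_map A : pohom X (quotient_space A) :=
  PoHom (@quotient_fun_monotone A) (@quotient_fun_continuous A).

Lemma quotient_map_surj A (z : quotient_space A) :
  exists x, quotient_map A x = z.
Proof. exact: corestriction_surj. Qed.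

Lemma mask_transition A B (z : quotient_space B) : (A <= B)%O ->
  range (masked_eval A) (mask (members A) (val z)).
Proof.
move=> /family_leP AB; have [x <-] := quotient_map_surj z; exists x => //.
apply/funext => f; rewrite /= /masked_eval /mask.
case: ifPn => // /set_mem fA.
by rewrite (mem_set (AB _ fA)).
Qed.

Definition transition_fun A B (AB : (A <= B)%O) (z : quotient_space B) :
    quotient_space A :=
  SigSub (mem_set (mask_transition z AB)).

Lemma transition_fun_monotone A B (AB : (A <= B)%O) :
  {homo transition_fun AB : z w / (z <= w)%O}.
Proof.
move=> z w /ptws_leP zw; apply/ptws_leP => f; rewrite /= /mask.
by case: ifPn => // _; exact: zw.
Qed.

Lemma transition_fun_continuous A B (AB : (A <= B)%O) :
  continuous (transition_fun AB).
Proof.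
apply: ptws_subspace_continuous => f; rewrite /= /mask.
case: (f \in members A).
  exact: (@ptws_coord_continuous _ R (range (masked_eval B)) f).
by move=> z; exact: cst_continuous.
Qed.

Definition transition A B (AB : (A <= B)%O) :
    pohom (quotient_space B) (quotient_space A) :=
  PoHom (@transition_fun_monotone A B AB) (@transition_fun_continuous A B AB).

Lemma transition_quotient A B (AB : (A <= B)%O) x :
  transition AB (quotient_map B x) = quotient_map A x.
Proof.
apply: val_inj; apply/funext => f; rewrite /= /masked_eval /mask.
case: ifPn => // /set_mem fA.
by rewrite (mem_set (family_leP _ _ AB _ fA)).
Qed.

Lemma transition_id A : transition (lexx A) = poid (quotient_space A).
Proof.
apply: pohom_eq; apply/funext => z; have [x <-] := quotient_map_surj z.
exact: transition_quotient.
Qed.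

Lemma transition_comp A B C (AB : (A <= B)%O) (BC : (B <= C)%O) :
  transition (le_trans AB BC) = pocomp (transition AB) (transition BC).
Proof.
apply: pohom_eq; apply/funext => z; have [x <-] := quotient_map_surj z.
rewrite transition_quotient; apply/esym.
apply: etrans (congr1 (transition AB) (transition_quotient BC x)) _.
exact: transition_quotient.
Qed.

Definition quotient_diagram :
    functor (poset_cat countable_family) (op PosComp) :=
  @Functor (poset_cat countable_family) (op PosComp) quotient_space transition
    transition_id
    (fun A B C (BC : (B <= C)%O) (AB : (A <= B)%O) => transition_comp AB BC).

Lemma quotient_cone_natural A B (AB : (A <= B)%O) :
  pocomp (transition AB) (quotient_map B) = quotient_map A.
Proof. by apply: pohom_eq; apply/funext => x; exact: transition_quotient. Qed.

Definition quotient_cone : cocone quotient_diagram :=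
  @Cocone (poset_cat countable_family) (op PosComp) quotient_diagram X
    quotient_map quotient_cone_natural.

Lemma quotient_cone_limit : is_colimit quotient_cone.
Proof.
apply: surjective_cone_limit.
- move=> A B.
  have [|C AC] := countable_family_directed (A := [set A; B]).
    by apply: finite_set_countable.
  by exists C; split; apply: AC; [left|right].
- have [A _] := countable_family_directed (countable0 countable_family).
  exact: (inhabits A).
- exact: quotient_map_surj.
- move=> x y xy; apply: contrapT => /(monotone_separation R)[f [fc fm yx]].
  have f1 : countable [set f] by exact: countable1.
  have f1c h : [set f] h -> continuous h by move=> ->.
  have f1m h : [set f] h -> {homo h : x y / (x <= y)%O >-> x <= y} by move=> ->.
  have /quotient_fun_le/(_ f erefl) := xy (CountableFamily f1 f1c f1m).
  by rewrite leNgt yx.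
Qed.

Lemma copresentable_separating_family : aleph1_copresentable (X : PosComp) ->
  exists A, forall x y, (forall f, members A f -> f x <= f y) -> (x <= y)%O.
Proof.
move=> copres.
have := copres _ _ countable_family_directed _ _ quotient_cone_limit.
(* The identity of X comes from the stage of some A: it factors as s after the
   quotient map to X_A. *)
move=> /type_colimit_jointly_surjective/(_ (poid X))[A [s sq]].
exists A => x y /quotient_fun_le xy.
have sqE z : pofun s (quotient_map A z) = z.
  exact: (congr1 (fun h : pohom X X => h z) sq).
by rewrite -(sqE x) -(sqE y); exact: pohom_monotone.
Qed.

End CountableQuotients.

Theorem corollary5p12 (R : realType) (X : PosComp) :
  aleph1_copresentable X -> metrisable R X.
Proof.
move=> copres; have [A Areflect] := copresentable_separating_family R copres.
apply: metrisable_of_separating_family Areflect.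
- exact: members_countable.
- exact: members_continuous.
- exact: members_monotone.
Qed.
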